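(* Let $m,n,s\ge 1$ be integers, let $T>0$, let $f:[0,T]\times\mathbb{R}^m\to\mathbb{R}^m$ be Lipschitz in the second variable with Lipschitz function $L(\cdot)\in L^\infty([0,T])$, i.e. $\|f(t,x)-f(t,y)\|_2\le L(t)\|x-y\|_2$ for all $(t,x),(t,y)\in[0,T]\times\mathbb{R}^m$, and let $L:=\|L(\cdot)\|_{L^\infty([0,T])}>0$. Let $A$ be a real $n\times m$ matrix with isometry constant $\delta_{2s}<1$. If $$T<\frac{1}{L}\ln\left(1+\frac{\sqrt{1-\delta_{2s}}}{\|A\|}\right),$$ then the pair consisting of the initial value problem $\dot x(t)=f(t,x(t))$, $t>0$, $x(0)=x^0$, and the observation $b=Ax(T)$ is $s$-sparse observable at time $T$.
   Context: For $x\in\mathbb{R}^m$, $\|x\|_0:=\#\{i: x_i\ne 0\}$, and $x$ is called $s$-sparse if $\|x\|_0\le s$. $\|x\|_2$ is the Euclidean norm and $\|A\|$ is the operator norm of $A$ induced by the Euclidean norms. For each integer $k\ge 1$, the isometry constant $\delta_k$ of $A$ is the smallest number such that $(1-\delta_k)\|x\|_2^2\le\|Ax\|_2^2\le(1+\delta_k)\|x\|_2^2$ holds for all $x\in\mathbb{R}^m$ with $\|x\|_0\le k$. A solution of the initial value problem on $[0,T]$ is a continuous function $x:[0,T]\to\mathbb{R}^m$ such that $t\mapsto f(t,x(t))$ is integrable and $x(t)=x^0+\int_0^t f(\sigma,x(\sigma))\,d\sigma$ for all $t\in[0,T]$. It is assumed that for every $x^0\in\mathbb{R}^m$ such a solution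 exists (it is then unique by the Lipschitz condition). The pair (initial value problem, observation $b=Ax(T)$) is called $s$-sparse observable at time $T>0$ if the knowledge of $b$ determines the $s$-sparse initial data vector $x^0$; that is, if for any solutions $x_1(\cdot)$ and $x_2(\cdot)$ corresponding to $s$-sparse initial data $x_1^0$ and $x_2^0$, respectively, with $Ax_1(T)=Ax_2(T)$, we have $x_1^0=x_2^0$. *)

(* Defs.v *)
(* MathComp / MathComp-Analysis; the reals are an arbitrary [R : realType] and
   vectors of R^m are columns ['cV[R]_m]. *)
From HB Require Import structures.
From mathcomp Require Import all_boot all_order all_algebra.
From mathcomp Require Import all_classical all_reals all_analysis.

Set Implicit Arguments.
Unset Strict Implicit.
Unset Printing Implicit Defensive.

Import Order.TTheory GRing.Theory Num.Theory.
Import numFieldNormedType.Exports.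

Local Open Scope classical_set_scope.
Local Open Scope ring_scope.

Definition l0norm (R : realType) (m : nat) (x : 'cV[R]_m) : nat :=
  #|[pred i | x i ord0 != 0]|.

Definition sparse (R : realType) (m : nat) (s : nat) (x : 'cV[R]_m) : Prop :=
  (l0norm x <= s)%N.

(* The library norm [`|x|] on matrices is the sup norm, not the Euclidean one. *)
Definition l2norm (R : realType) (m : nat) (x : 'cV[R]_m) : R :=
  Num.sqrt (\sum_i x i ord0 ^+ 2).

Definition opnorm (R : realType) (n m : nat) (A : 'M[R]_(n, m)) : R :=
  sup [set l2norm (A *m x) | x in [set x : 'cV[R]_m | l2norm x <= 1]].

Definition isometry_bound (R : realType) (n m : nat) (A : 'M[R]_(n, m))
    (k : nat) (delta : R) : Prop :=
  forall x : 'cV[R]_m, sparse k x ->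
    (1 - delta) * l2norm x ^+ 2 <= l2norm (A *m x) ^+ 2
      <= (1 + delta) * l2norm x ^+ 2.

Definition is_isometry_constant (R : realType) (n m : nat) (A : 'M[R]_(n, m))
    (k : nat) (delta : R) : Prop :=
  isometry_bound A k delta /\
  (forall delta' : R, isometry_bound A k delta' -> delta <= delta').

(* [lebesgue_measure] lives on the Borel sigma-algebra; measurability and
   integrability in the sense of Lebesgue are those of the completed measure.
   Functions on [0, T] are represented by total functions on R whose values
   outside [0, T] are irrelevant. *)
Definition in_Linfty (R : realType) (T : R) (g : R -> R) : Prop :=
  g \_ `[0, T] \in Lfun (@completed_lebesgue_measure R) +oo%E.

Definition Linfty_norm (R : realType) (T : R) (g : R -> R) : R :=
  fine (Lnorm (@completed_lebesgue_measure R) +oo%E (EFin \o (g \_ `[0, T]))).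

(* The topology of ['cV[R]_m] is the product one, hence the Euclidean one;
   the vector-valued integral is taken coordinatewise. *)
Definition is_solution (R : realType) (m : nat) (f : R -> 'cV[R]_m -> 'cV[R]_m)
    (T : R) (x0 : 'cV[R]_m) (x : R -> 'cV[R]_m) : Prop :=
  [/\ {within `[0, T], continuous x},
      forall i : 'I_m, (@completed_lebesgue_measure R).-integrable `[0, T]
        (fun t => (f t (x t) i ord0)%:E)
    & forall t : R, 0 <= t <= T ->
        x t = x0 + \col_i
          \int[@completed_lebesgue_measure R]_(sigma in `[0, t])
            f sigma (x sigma) i ord0].

Definition sparse_observable (R : realType) (m n : nat)
    (f : R -> 'cV[R]_m -> 'cV[R]_m) (A : 'M[R]_(n, m)) (s : nat) (T : R) :
    Prop :=
  forall (x10 x20 : 'cV[R]_m) (x1 x2 : R -> 'cV[R]_m),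
    sparse s x10 -> sparse s x20 ->
    is_solution f T x10 x1 -> is_solution f T x20 x2 ->
    A *m x1 T = A *m x2 T -> x10 = x20.

(* Main.v *)
(* Let z be the difference of two solutions with the same observation, put
   a = |z(0)|, and let K be the maximum of |z(t)| exp(- L t) on [0, T].
   Integrating the Lipschitz bound gives |z(t) - z(0)| <= K (exp(L t) - 1) for
   all t; at a point where the maximum is attained this yields K <= a, which
   replaces Gronwall's lemma. Since A z(T) = 0,
     sqrt(1 - delta) a <= |A z(0)| = |A (z(T) - z(0))| <= |A| a (exp(L T) - 1),
   and the bound on T then forces a = 0. *)
Require Import Defs.
From HB Require Import structures.
From mathcomp Require Import all_boot all_order all_algebra.
From mathcomp Require Import all_classical all_reals all_analysis.
From mathcomp Require Import measurable_realfun ess_sup_inf.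
From mathcomp Require Import ring lra.

Set Implicit Arguments.
Unset Strict Implicit.
Unset Printing Implicit Defensive.

Import Order.TTheory GRing.Theory Num.Theory.
Import numFieldNormedType.Exports.

Local Open Scope classical_set_scope.
Local Open Scope ring_scope.

(** * Euclidean norm, operator norm and sparsity *)

Section Euclidean.
Variable R : realType.
Implicit Types (m n : nat).

Lemma l2norm_ge0 m (x : 'cV[R]_m) : 0 <= l2norm x.
Proof. exact: sqrtr_ge0. Qed.

Lemma sqr_l2norm m (x : 'cV[R]_m) : l2norm x ^+ 2 = \sum_i x i ord0 ^+ 2.
Proof. by rewrite sqr_sqrtr// sumr_ge0// => i _; exact: sqr_ge0. Qed.

Lemma l2norm_eq0 m (x : 'cV[R]_m) : l2norm x = 0 -> x = 0.
Proof.
move=> x0; have /eqP := sqr_l2norm x; rewrite x0 expr0n eq_sym psumr_eq0; last first.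
  by move=> i _; exact: sqr_ge0.
move=> /allP xi0; apply/colP => i; rewrite mxE.
by have := xi0 i (mem_index_enum i); rewrite sqrf_eq0 => /eqP.
Qed.

Lemma l2norm0 m : l2norm (0 : 'cV[R]_m) = 0.
Proof. by rewrite /l2norm big1 ?sqrtr0// => i _; rewrite mxE expr0n. Qed.

Lemma l2normZ m (c : R) (x : 'cV[R]_m) : l2norm (c *: x) = `|c| * l2norm x.
Proof.
rewrite /l2norm -sqrtr_sqr -sqrtrM ?sqr_ge0// mulr_sumr.
by congr Num.sqrt; apply: eq_bigr => i _; rewrite mxE exprMn.
Qed.

Lemma l2normN m (x : 'cV[R]_m) : l2norm (- x) = l2norm x.
Proof. by rewrite -scaleN1r l2normZ normrN1 mul1r. Qed.

(** With [a] and [b] the norms of [x] and [y], summing [(b x_i - a y_i)^2 >= 0] bounds [2ab] times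
    the left side by [2(ab)^2]. Cancelling [2ab] requires both norms to be nonzero, hence the two
    degenerate cases. *)
Lemma CauchySchwarz_l2norm m (x y : 'cV[R]_m) :
  \sum_i x i ord0 * y i ord0 <= l2norm x * l2norm y.
Proof.
have [/l2norm_eq0->|x0] := eqVneq (l2norm x) 0.
  by rewrite big1 ?l2norm0 ?mul0r// => i _; rewrite mxE mul0r.
have [/l2norm_eq0->|y0] := eqVneq (l2norm y) 0.
  by rewrite big1 ?l2norm0 ?mulr0// => i _; rewrite mxE mulr0.
set a := l2norm x; set b := l2norm y.
have ab0 : 0 < 2 * (a * b).
  by rewrite !mulr_gt0 ?ltr0n// lt_neqAle l2norm_ge0 eq_sym andbT.
rewrite -(ler_pM2l ab0).
apply: (@le_trans _ _ (\sum_i (b ^+ 2 * x i ord0 ^+ 2 + a ^+ 2 * y i ord0 ^+ 2))).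
  rewrite mulr_sumr; apply: ler_sum => i _; rewrite -subr_ge0.
  have -> : b ^+ 2 * x i ord0 ^+ 2 + a ^+ 2 * y i ord0 ^+ 2 -
    2 * (a * b) * (x i ord0 * y i ord0) =
    (b * x i ord0 - a * y i ord0) ^+ 2 by ring.
  exact: sqr_ge0.
rewrite big_split/= -!mulr_sumr -!sqr_l2norm -/a -/b.
by rewrite le_eqVlt; apply/orP; left; apply/eqP; ring.
Qed.

Lemma ler_l2normD m (x y : 'cV[R]_m) : l2norm (x + y) <= l2norm x + l2norm y.
Proof.
rewrite -ler_sqr ?nnegrE ?addr_ge0 ?l2norm_ge0//.
rewrite sqrrD !sqr_l2norm.
have -> : \sum_i (x + y) i ord0 ^+ 2 = \sum_i x i ord0 ^+ 2 +
    (\sum_i x i ord0 * y i ord0) *+ 2 + \sum_i y i ord0 ^+ 2.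
  rewrite -sumrMnl -!big_split/=; apply: eq_bigr => i _.
  by rewrite mxE sqrrD.
by rewrite lerD2r lerD2l lerMn2r CauchySchwarz_l2norm.
Qed.

Lemma continuous_l2norm m : continuous (@l2norm R m).
Proof.
move=> x; apply: (@continuous_comp _ _ _ (fun x : 'cV[R]_m => \sum_i x i ord0 ^+ 2));
  last exact: sqrt_continuous.
apply: continuous_big => [|i _ y]; first exact: add_continuous.
apply: (@continuous_comp _ _ _ (fun x : 'cV[R]_m => x i ord0) (fun r => r ^+ 2)).
  exact: coord_continuous.
exact: exprn_continuous.
Qed.

(** Scaling [x] to norm 1 puts it in the set defining [opnorm]. A [sup] is an upper bound only if
    that set is bounded, which the Frobenius norm of [A] provides. *)
Lemma ler_opnorm m n (A : 'M[R]_(n, m)) (x : 'cV[R]_m) :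
  l2norm (A *m x) <= opnorm A * l2norm x.
Proof.
pose r i : 'cV[R]_m := (row i A)^T.
(* Cauchy-Schwarz is applied to each row; the bound on the absolute value comes from using it for
   both [y] and [- y]. *)
have frob y : l2norm (A *m y) <= Num.sqrt (\sum_i l2norm (r i) ^+ 2) * l2norm y.
  rewrite -(ler_sqr (l2norm_ge0 _)) ?nnegrE ?mulr_ge0 ?sqrtr_ge0 ?l2norm_ge0//.
  rewrite [in leLHS]sqr_l2norm exprMn.
  rewrite [Num.sqrt _ ^+ 2]sqr_sqrtr ?sumr_ge0// => [|i _]; last exact: sqr_ge0.
  rewrite mulr_suml; apply: ler_sum => i _.
  rewrite -exprMn -[leLHS]real_normK ?num_real// ler_sqr ?nnegrE ?mulr_ge0 ?l2norm_ge0//.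
  have Ay z : (A *m z) i ord0 = \sum_j r i j ord0 * z j ord0.
    by rewrite !mxE; apply: eq_bigr => j _; rewrite !mxE.
  rewrite ler_norml; apply/andP; split; last by rewrite Ay CauchySchwarz_l2norm.
  rewrite lerNl -(l2normN y); apply: le_trans (CauchySchwarz_l2norm _ _).
  by rewrite -Ay mulmxN [in leRHS]mxE.
have [/l2norm_eq0->|x0] := eqVneq (l2norm x) 0.
  by rewrite mulmx0 !l2norm0 mulr0.
have xgt0 : 0 < l2norm x by rewrite lt_neqAle l2norm_ge0 eq_sym x0.
rewrite -ler_pdivrMr// mulrC.
have -> : (l2norm x)^-1 * l2norm (A *m x) = l2norm (A *m ((l2norm x)^-1 *: x)).
  by rewrite -scalemxAr l2normZ ger0_norm// invr_ge0 l2norm_ge0.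
apply: ub_le_sup; last first.
  exists ((l2norm x)^-1 *: x) => //=.
  by rewrite l2normZ ger0_norm ?invr_ge0 ?l2norm_ge0// mulVf.
exists (Num.sqrt (\sum_i l2norm (r i) ^+ 2)) => _ [y /= y1 <-].
by apply: (le_trans (frob y)); rewrite ler_piMr// sqrtr_ge0.
Qed.

(** The support of a difference lies in the union of the supports; this is where the order [2 * s]
    of the isometry constant comes from. *)
Lemma sparseB m s (x y : 'cV[R]_m) :
  sparse s x -> sparse s y -> sparse (2 * s) (x - y).
Proof.
rewrite /sparse /l0norm => xs ys; rewrite mul2n -addnn.
apply: leq_trans (leq_add xs ys); rewrite -cardUI.
apply: leq_trans (leq_addr _ _); apply: subset_leq_card.
apply/fintype.subsetP => i; rewrite !inE !mxE.
by apply: contraR; rewrite negb_or !negbK => /andP[/eqP-> /eqP->]; rewrite subr0.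
Qed.

End Euclidean.

(** Triangle inequality for a coordinatewise integral. The domination is only almost everywhere
    because an essential supremum bounds the Lipschitz function only there. *)
Lemma ler_l2norm_integral (R : realType) (m : nat) d (X : measurableType d)
    (mu : {measure set X -> \bar R}) (D : set X) (g : X -> 'cV[R]_m) (h : X -> R) :
  measurable D ->
  (forall i, mu.-integrable D (fun t => (g t i ord0)%:E)) ->
  mu.-integrable D (EFin \o h) -> (forall t, D t -> 0 <= h t) ->
  {ae mu, forall t, D t -> l2norm (g t) <= h t} ->
  l2norm (\col_i \int[mu]_(t in D) g t i ord0) <= \int[mu]_(t in D) h t.
Proof.
move=> mD ig ih h0 gh.
set v := \col_i _; pose q t := \sum_i v i ord0 * g t i ord0.
have iqi i : mu.-integrable D (EFin \o (fun t => v i ord0 * g t i ord0)).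
  exact: (integrableZl mD (v i ord0) (ig i)).
have qE : EFin \o q = (fun t => \sum_i (v i ord0 * g t i ord0)%:E)%E.
  by apply/funext => t; rewrite /= /q sumEFin.
have iq : mu.-integrable D (EFin \o q).
  by rewrite qE; apply: integrable_sum => // i _; exact: iqi.
(* Testing v against itself reduces the claim to scalar integrals. *)
have vq : l2norm v ^+ 2 = \int[mu]_(t in D) q t.
  rewrite sqr_l2norm /Rintegral -[X in integral _ _ X]/(EFin \o q) qE.
  rewrite integral_sum//.
  rewrite -sum_fine; last first.
    by move=> i _; apply: integrable_fin_num => //; exact: iqi.
  apply: eq_bigr => i _; rewrite -/(Rintegral mu D _) RintegralZl//; last exact: ig.
  by rewrite expr2 [X in _ * X]mxE.
have vh : l2norm v ^+ 2 <= l2norm v * \int[mu]_(t in D) h t.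
  rewrite vq -RintegralZl//; apply: le_trans (ler_norm _) _.
  apply: le_trans (le_normr_Rintegral mD iq) _.
  have ivh : mu.-integrable D (EFin \o (fun t => l2norm v * h t)).
    exact: (integrableZl mD (l2norm v) ih).
  have iaq := integrable_abse iq.
  apply: fine_le; [exact: integrable_fin_num|exact: integrable_fin_num|].
  apply: ae_ge0_le_integral => //.
  - exact: (measurable_int mu iaq).
  - by move=> t Dt; rewrite lee_fin mulr_ge0 ?l2norm_ge0 ?h0.
  - exact: (measurable_int mu ivh).
  - apply: filterS gh => t /[apply] ght; rewrite lee_fin.
    apply: le_trans (_ : l2norm v * l2norm (g t) <= _); last first.
      by rewrite ler_wpM2l// l2norm_ge0.
    rewrite ler_norml CauchySchwarz_l2norm andbT lerNl -sumrN.
    rewrite -(l2normN v); apply: le_trans (CauchySchwarz_l2norm _ _).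
    by apply: ler_sum => i _; rewrite [in leRHS]mxE mulNr.
(* One factor [l2norm v] is cancelled in [vh]; if it vanishes, nonnegativity of [h] suffices. *)
have [->|v0] := eqVneq (l2norm v) 0; first exact: Rintegral_ge0.
by rewrite -(ler_pM2l (_ : 0 < l2norm v)) ?lt_neqAle ?l2norm_ge0 1?eq_sym ?v0// -expr2.
Qed.

(** * Completed Lebesgue measure: an exponential integral and the essential bound *)

Section completed.
Variable R : realType.
Local Notation mu := (@lebesgue_measure R).
Local Notation cmu := (@completed_lebesgue_measure R).

(* The completed Lebesgue measure lives on the Caratheodory sigma-algebra; the
   Lebesgue measure is its pushforward along the identity to the Borel one. *)
Lemma measurable_fun_idfun_completed :
  measurable_fun [set: caratheodory_type (wlength (R:=R) idfun)^*%mu] 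
     (idfun : caratheodory_type (wlength (R:=R) idfun)^*%mu -> measurableTypeR R).
Proof. by move=> _ Y mY; rewrite setTI; exact: sub_caratheodory. Qed.

Lemma measurable_itv_completed (i : interval R) :
  measurable ([set` i] : set (caratheodory_type (wlength (R:=R) idfun)^*%mu)).
Proof. by apply: sub_caratheodory; exact: measurable_itv. Qed.

Lemma integral_completed_lebesgue (D : set R) (f : R -> \bar R) :
  measurable D -> measurable_fun D f ->
  (forall t, D t -> 0 <= f t)%E ->
  (\int[cmu]_(x in D) f x = \int[mu]_(x in D) f x)%E.
Proof.
move=> mD mf f0.
have /= <- := ge0_integral_pushforward measurable_fun_idfun_completed cmu mD mf.
  by apply: eq_measure_integral => //; exact: measurable_fun_idfun_completed.
by move=> y yD; apply: f0; exact: set_mem yD.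
Qed.

(** The integrand is continuous, so the integral passes to the Borel Lebesgue measure, where the
    fundamental theorem of calculus applies with primitive [expR (L * x)]. The one-point interval
    [t = 0] is treated apart. *)
Lemma integral_completed_expR (L t : R) : 0 <= L -> 0 <= t ->
  (\int[cmu]_(x in `[0%R, t]) (L * expR (L * x))%:E = (expR (L * t) - 1)%:E)%E.
Proof.
move=> L0 t0.
have cE : continuous (fun x : R => L * expR (L * x)).
  move=> x; apply: cvgM; first exact: cvg_cst.
  apply: (@continuous_comp _ _ _ ( *%R L) (@expR R)); last exact: continuous_expR.
  exact: mulrl_continuous.
have dE (x : R) : is_derive x 1 (fun x : R => expR (L * x)) (L * expR (L * x)).
  by apply: is_derive_eq; rewrite /GRing.scale/=; ring.
rewrite integral_completed_lebesgue//; last 2 first.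
- apply/measurable_EFinP/measurable_funTS; apply: continuous_measurable_fun.
  exact: cE.
- by move=> x _; rewrite lee_fin mulr_ge0// expR_ge0.
move: t0; rewrite le_eqVlt => /predU1P[<-|t0].
  by rewrite set_itv1 integral_set1 mulr0 expR0 subrr.
rewrite (@continuous_FTC2 _ _ (fun x => expR (L * x)))//.
- by rewrite mulr0 expR0 EFinB.
- exact: continuous_subspaceT.
- have cF : continuous (fun x : R => expR (L * x)).
    by move=> x; apply/differentiable_continuous/derivable1_diffP/ex_derive.
  split; first by move=> x _; exact: ex_derive.
    exact/cvg_at_right_filter/cF.
  exact/cvg_at_left_filter/cF.
- by move=> x _; rewrite derive1E derive_val.
Qed.

Lemma integrable_completed_expR (L t : R) : 0 <= L -> 0 <= t ->
  cmu.-integrable `[0, t] (EFin \o (fun x => L * expR (L * x))).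
Proof.
move=> L0 t0; apply/integrableP; split; last first.
  under eq_integral.
    move=> x _; rewrite gee0_abs/=; last by rewrite lee_fin mulr_ge0// expR_ge0.
    over.
  by rewrite integral_completed_expR// ltry.
apply/measurable_EFinP; apply: measurable_funTS.
have mE : measurable_fun [set: measurableTypeR R] (fun x : R => L * expR (L * x)).
  by apply: measurable_funM => //; apply: measurableT_comp => //; exact: measurable_funM.
exact: (measurableT_comp mE measurable_fun_idfun_completed).
Qed.

(** Positivity of the norm excludes two default values: the 0 that [Lnorm] takes on a space of
    measure zero, and the 0 that [fine] assigns to [-oo]. *)
Lemma ae_le_Linfty_norm (T : R) (g : R -> R) : in_Linfty T g -> 0 < Linfty_norm T g ->
  {ae cmu, forall t, `[0, T]%classic t -> g t <= Linfty_norm T g}.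
Proof.
rewrite /Linfty_norm => /sub_Lfun_finLfun; rewrite inE /= /finite_norm.
rewrite unlock /=; case: ifPn => [_|_ _]; last by rewrite ltxx.
move=> fin L0.
apply: filterS (ess_sup_ge cmu (abse \o (EFin \o g \_ `[0, T]))) => t /= gt tT.
rewrite -lee_fin fineK; last first.
  by rewrite fin_numElt fin andbT; case: ess_sup L0 fin => [r _ _||] //=; rewrite ?ltNyr ?ltxx.
apply: le_trans gt; rewrite patchE mem_set//=.
by rewrite lee_fin ler_norm.
Qed.

End completed.

(** * Growth of the difference of two solutions *)

Section solutions.
Variables (R : realType) (m : nat) (f : R -> 'cV[R]_m -> 'cV[R]_m).
Variables (T L : R) (Lfct : R -> R).
Hypothesis L0 : 0 <= L.
Hypothesis fLip : forall t x y, 0 <= t <= T ->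
  l2norm (f t x - f t y) <= Lfct t * l2norm (x - y).
Hypothesis LfctL : {ae @completed_lebesgue_measure R,
  forall t, `[0, T]%classic t -> Lfct t <= L}.
Variables (x10 x20 : 'cV[R]_m) (x1 x2 : R -> 'cV[R]_m).
Hypotheses (sol1 : is_solution f T x10 x1) (sol2 : is_solution f T x20 x2).

(** Subtracting the integral equations leaves the integral of [f s (x1 s) - f s (x2 s)], whose norm
    is almost everywhere at most [K * (L * expR (L * s))]; this integrates to the right side. *)
Lemma is_solution_drift_le (K : R) : 0 <= K ->
  (forall t, 0 <= t <= T -> l2norm (x1 t - x2 t) <= K * expR (L * t)) ->
  forall t, 0 <= t <= T ->
  l2norm (x1 t - x2 t - (x10 - x20)) <= K * (expR (L * t) - 1).
Proof.
move=> K0 zK t /andP[t0 tT].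
have tt : 0 <= t <= T by rewrite t0.
case: sol1 sol2 => [_ i1 e1] [_ i2 e2].
have sub0T : `[0, t]%classic `<=` `[0, T].
  by apply: subset_itvl; rewrite bnd_simp.
have mD := measurable_itv_completed `[0, t].
have mT := measurable_itv_completed `[0, T].
have j1 i := integrableS mT mD sub0T (i1 i).
have j2 i := integrableS mT mD sub0T (i2 i).
have -> : x1 t - x2 t - (x10 - x20) = \col_i
    \int[@completed_lebesgue_measure R]_(s in `[0, t])
       (f s (x1 s) - f s (x2 s)) i ord0.
  rewrite e1// e2//; apply/colP => i; rewrite !mxE.
  under [in RHS]eq_Rintegral do rewrite !mxE.
  by rewrite RintegralB//; [ring|exact: j1|exact: j2].
have iE := integrable_completed_expR L0 t0.
have -> : K * (expR (L * t) - 1) =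
    \int[@completed_lebesgue_measure R]_(s in `[0, t]) (K * (L * expR (L * s))).
  by rewrite RintegralZl// /Rintegral integral_completed_expR.
apply: ler_l2norm_integral => //.
- move=> i; apply: eq_integrable (integrableB mD (j1 i) (j2 i)) => // s _.
  by rewrite !mxE EFinB.
- exact: (integrableZl mD K iE).
- by move=> s _; rewrite !mulr_ge0// expR_ge0.
- apply: (@filterS _ _ (ae_filter_ringOfSetsType _)) LfctL => s LsL Ds.
  have DTs := sub0T _ Ds.
  have sT : 0 <= s <= T by move: DTs; rewrite /= in_itv.
  apply: le_trans (fLip _ _ sT) _.
  apply: (@le_trans _ _ (L * l2norm (x1 s - x2 s))).
    by rewrite ler_wpM2r ?l2norm_ge0// LsL.
  by rewrite mulrCA ler_wpM2l// zK.
Qed.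

Lemma is_solution_drift_initial_le : 0 <= T ->
  l2norm (x1 T - x2 T - (x10 - x20)) <= l2norm (x10 - x20) * (expR (L * T) - 1).
Proof.
(* The maximum of this weighted gap is the least [K] admissible in [is_solution_drift_le]. *)
move=> T0; pose w t := l2norm (x1 t - x2 t) * expR (- (L * t)).
have cw : {within `[0, T], continuous w}.
  case: sol1 sol2 => [c1 _ _] [c2 _ _] t.
  apply: cvgM.
    apply: (@continuous_comp (subspace _) _ _ (fun t => x1 t - x2 t) (@l2norm R m)).
      by apply: cvgB; [exact: c1|exact: c2].
    exact: continuous_l2norm.
  apply: continuous_subspaceT => u.
  apply: (@continuous_comp _ _ _ (fun u => - (L * u)) (@expR R)).
    by apply: cvgN; exact: mulrl_continuous.
  exact: continuous_expR.
have [c c0T wc] := EVT_max T0 cw.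
have cT : 0 <= c <= T by move: c0T; rewrite in_itv.
have expK t : expR (- (L * t)) * expR (L * t) = 1 by rewrite -expRD addNr expR0.
have w0 t : 0 <= w t by rewrite mulr_ge0 ?l2norm_ge0 ?expR_ge0.
have zw t : l2norm (x1 t - x2 t) = w t * expR (L * t).
  by rewrite /w -mulrA expK mulr1.
have drift := is_solution_drift_le (w0 c) _.
have {}drift t (tT : 0 <= t <= T) :
    l2norm (x1 t - x2 t - (x10 - x20)) <= w c * (expR (L * t) - 1).
  by apply: drift tT => s sT; rewrite zw ler_wpM2r ?expR_ge0// wc// in_itv.
apply: le_trans (drift T _) _; first by rewrite T0 lexx.
apply: ler_wpM2r; first by rewrite subr_ge0 -expR0 ler_expR mulr_ge0.
(* At the maximizer the gap equals [w c * expR (L * c)], while the drift is at most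
   [w c * expR (L * c) - w c]. The exponentials cancel, leaving [w c <= l2norm (x10 - x20)]. *)
have := ler_l2normD (x1 c - x2 c - (x10 - x20)) (x10 - x20).
rewrite subrK zw; have := drift c cT.
by rewrite mulrBr; lra.
Qed.

End solutions.

(** * Isometry lower bound against the drift upper bound *)

Theorem theorem1 (R : realType) (m n s : nat)
    (hm : (1 <= m)%N) (hn : (1 <= n)%N) (hs : (1 <= s)%N)
    (T : R) (hT : 0 < T)
    (f : R -> 'cV[R]_m -> 'cV[R]_m) (Lfct : R -> R)
    (hLfct : in_Linfty T Lfct)
    (hLip : forall (t : R) (x y : 'cV[R]_m), 0 <= t <= T ->
       l2norm (f t x - f t y) <= Lfct t * l2norm (x - y))
    (hex : forall x0 : 'cV[R]_m, exists x : R -> 'cV[R]_m,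
       is_solution f T x0 x)
    (L : R) (hL : L = Linfty_norm T Lfct) (hL0 : 0 < L)
    (A : 'M[R]_(n, m)) (delta : R)
    (hdelta : is_isometry_constant A (2 * s) delta) (hdelta1 : delta < 1)
    (hTL : T < 1 / L * ln (1 + Num.sqrt (1 - delta) / opnorm A)) :
  sparse_observable f A s T.
Proof.
move=> x10 x20 x1 x2 s1 s2 sol1 sol2 AxT.
apply/eqP; rewrite -subr_eq0; apply/eqP; set z0 := x10 - x20.
apply: l2norm_eq0; apply/eqP; apply: contraT => z0N0.
have a0 : 0 < l2norm z0 by rewrite lt_neqAle eq_sym z0N0 l2norm_ge0.
have LfctL : {ae @completed_lebesgue_measure R,
    forall t, `[0, T]%classic t -> Lfct t <= L}.
  by rewrite hL; apply: ae_le_Linfty_norm => //; rewrite -hL.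
have drift := is_solution_drift_initial_le (ltW hL0) hLip LfctL sol1 sol2 (ltW hT).
have Az0 : l2norm (A *m z0) = l2norm (A *m (x1 T - x2 T - z0)).
  by rewrite [in RHS]mulmxBr (mulmxBr A (x1 T)) AxT subrr sub0r l2normN.
have lower : Num.sqrt (1 - delta) * l2norm z0 <= l2norm (A *m z0).
  have d0 : 0 <= 1 - delta by rewrite subr_ge0 ltW.
  rewrite -ler_sqr ?nnegrE ?mulr_ge0 ?sqrtr_ge0 ?l2norm_ge0//.
  rewrite exprMn [Num.sqrt _ ^+ 2]sqr_sqrtr//.
  by have /andP[] := hdelta.1 z0 (sparseB s1 s2).
have A0 : 0 <= opnorm A.
  by rewrite -(pmulr_lge0 _ a0); apply: le_trans (ler_opnorm A z0); exact: l2norm_ge0.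
have upper : l2norm (A *m z0) <= opnorm A * (l2norm z0 * (expR (L * T) - 1)).
  by rewrite Az0; apply: le_trans (ler_opnorm _ _) _; exact: ler_wpM2l.
have {lower upper} key : Num.sqrt (1 - delta) <= opnorm A * (expR (L * T) - 1).
  by rewrite -(ler_pM2r a0) -mulrA [X in opnorm A * X]mulrC (le_trans lower).
(* Division by zero yields 0, so a vanishing [opnorm A] would turn [hTL] into [T < 0]. *)
have ApN0 : opnorm A != 0.
  apply: contraTN hTL => /eqP->.
  by rewrite invr0 mulr0 addr0 ln1 mulr0 -leNgt ltW.
have Ap : 0 < opnorm A by rewrite lt_neqAle eq_sym ApN0.
have q0 : 0 <= Num.sqrt (1 - delta) / opnorm A by rewrite divr_ge0 ?sqrtr_ge0.
(* Exponentiating the bound on [T] gives [opnorm A * (expR (L * T) - 1) < Num.sqrt (1 - delta)], the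
   negation of [key]. *)
move: hTL; rewrite mul1r ltr_pdivlMl//.
rewrite -ltr_expR lnK ?posrE; last exact: ltr_pwDl.
rewrite -ltrBlDl.
by rewrite ltr_pdivlMr// ltNge mulrC key.
Qed.
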